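(* Let $H$ be a nonnegative weighted graph of even order $n\ge 4$ with weighted adjacency matrix $B_H$, let $s=\sum_{u<v}(B_H)_{uv}$, $t=\sum_{u<v}(B_H)_{uv}^2$, $N=n+1$, and let $M>s$ be real. Let $W_M(H)$ be the weighted cone over $H$ with cone weight $M$, and set $T=\frac{4Mn^2-4s}{N}$ and $Q=\sqrt{2nM^2+2t}$. Then $$\frac{a(B_H)}{4M}\le\Phi(W_M(H))-T\le\frac{N\,a(B_H)}{4(M-s)},$$ and correspondingly $$\frac{a(B_H)}{4MQ}\le\operatorname{FR}_{\min}(W_M(H))-\frac{T}{Q}\le\frac{N\,a(B_H)}{4(M-s)Q}.$$ If $M\ge 2s$ and $M>0$, then the upper bound $\frac{N a(B_H)}{4(M-s)}$ is at most $\frac{N\,a(B_H)}{2M}$.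
   Context: A nonnegative weighted graph is a pair $(V,w)$ with $V$ a finite set and $w:\binom{V}{2}\to[0,\infty)$; its weighted adjacency matrix $W=(w_{uv})$ is symmetric with zero diagonal. Its order is $|V|$. For a weighted adjacency matrix $W$ of order $N$, a labeling is a bijection $\pi:\mathbb{Z}_N\to V$, and $W_\pi$ is the matrix indexed by $\mathbb{Z}_N$ with entries $W_\pi(x,y)=w_{\pi(x)\pi(y)}$. Let $F_N(r,x)=\frac{1}{\sqrt N}e^{-2\pi i rx/N}$ for $r,x\in\mathbb{Z}_N$. For a matrix $C$, $\|C\|_1=\sum_{r,v}|C_{rv}|$ and $\|C\|_2=(\sum_{r,v}|C_{rv}|^2)^{1/2}$. Define $\Phi(W)=\min_\pi\|F_NW_\pi F_N\|_1$, the minimum over all labelings, and, for $W\neq 0$, $\operatorname{FR}_{\min}(W)=\Phi(W)/\|W\|_2$. The weighted cone $W_M(H)$ is the weighted graph of order $N=n+1$ obtained from $H$ by adjoining one new vertex $c$ and giving every edge from $c$ to a vertex of $H$ weight $M$ (weights inside $H$ are unchanged); the same symbol denotes its weighted adjacency matrix. Let $\mathcal I_n$ be the set of fixed-point-free involutions of the vertex set of $H$ (permutations $\tau$ with $\tau^2=\mathrm{id}$ and $\tau(v)\ne v$ for all $v$), and let $P_\tau$ be the permutation matrix of $\tau$. Define $a(B_H)=\min_{\tau\in\mathcal I_n}\frac14\|B_H-P_\tau B_HP_\tau\|_2^2$. *)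

(* Defs.v *)
From HB Require Import structures.
From mathcomp Require Import all_boot all_order all_algebra all_fingroup.
From mathcomp Require Import complex.
From mathcomp Require Import all_classical all_reals all_analysis.

Set Implicit Arguments.
Unset Strict Implicit.
Unset Printing Implicit Defensive.

Import Order.TTheory GRing.Theory Num.Theory.
Local Open Scope ring_scope.
Local Open Scope complex_scope.

(* A weight on unordered pairs is encoded by a symmetric function vanishing on
   the diagonal. *)
Record nonneg_wgraph (R : realType) (V : finType) (w : V -> V -> R) : Prop := {
  wgraph_sym : forall u v, w u v = w v u;
  wgraph_diag : forall v, w v v = 0;
  wgraph_ge0 : forall u v, 0 <= w u v
}.

(* Rows and columns are indexed by V through its enumeration [enum_val]. *)
Definition adjmx (R : realType) (V : finType) (w : V -> V -> R) : 'M[R]_#|V| :=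
  \matrix_(i, j) w (enum_val i) (enum_val j).

(* The minimum of f over {x | P x}; the value is 0 when that set is empty. *)
Definition finmin (R : realType) (T : finType) (P : pred T) (f : T -> R) : R :=
  if [pick x | P x] is Some x0 then f [arg min_(x < x0 | P x) f x]%O else 0.

Lemma finmin_le (R : realType) (T : finType) (P : pred T) (f : T -> R) (x : T) :
  P x -> finmin P f <= f x.
Proof.
rewrite /finmin; case: pickP => [x0 Px0 Px|/(_ x) -> //].
by case: arg_minP => // y _ /(_ x Px).
Qed.

Lemma finmin_attained (R : realType) (T : finType) (P : pred T) (f : T -> R)
    (x : T) : P x -> exists2 y, P y & finmin P f = f y.
Proof.
rewrite /finmin; case: pickP => [x0 Px0 _|/(_ x) -> //].
by case: arg_minP => // y Py _; exists y.
Qed.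

Definition expi (R : realType) (theta : R) : R[i] := cos theta +i* sin theta.

(* 'I_N serves as the set of residues Z/N. *)
Definition dft (R : realType) (N : nat) : 'M[R[i]]_N :=
  \matrix_(r, x) (((Num.sqrt (N%:R : R))^-1)%:C
                  * expi (- (2 * pi * r%:R * x%:R / N%:R))).

Definition norm1 (R : realType) (m n : nat) (C : 'M[R[i]]_(m, n)) : R :=
  \sum_(i < m) \sum_(j < n) Normc.normc (C i j).

Definition norm2 (R : realType) (m n : nat) (C : 'M[R]_(m, n)) : R :=
  Num.sqrt (\sum_(i < m) \sum_(j < n) `|C i j| ^+ 2).

Definition labeling (V : finType) (p : {ffun 'I_#|V| -> V}) : bool :=
  `[< bijective p >].

Lemma labeling_enum_val (V : finType) :
  labeling [ffun i : 'I_#|V| => enum_val i : V].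
Proof.
apply/asboolP; exists enum_rank => x; rewrite ffunE; first exact: enum_valK.
exact: enum_rankK.
Qed.

Definition labeled_mx (R : realType) (V : finType) (w : V -> V -> R)
    (p : {ffun 'I_#|V| -> V}) : 'M[R]_#|V| :=
  \matrix_(x, y) w (p x) (p y).

Definition Phi (R : realType) (V : finType) (w : V -> V -> R) : R :=
  finmin (@labeling V) (fun p =>
    norm1 (dft R #|V| *m map_mx (real_complex R) (labeled_mx w p)
           *m dft R #|V|)).

Definition FRmin (R : realType) (V : finType) (w : V -> V -> R) : R :=
  Phi w / norm2 (adjmx w).

(* The new vertex is [None]. *)
Definition wcone (R : realType) (V : finType) (M : R) (w : V -> V -> R)
    (a b : option V) : R :=
  match a, b with
  | Some u, Some v => w u v
  | None, None => 0
  | _, _ => M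
  end.

Lemma wcone_wgraph (R : realType) (V : finType) (M : R) (w : V -> V -> R) :
  0 <= M -> nonneg_wgraph w -> nonneg_wgraph (wcone M w).
Proof.
move=> M0 [ws wd wp]; split.
- by move=> [u|] [v|] /=.
- by move=> [u|] /=.
- by move=> [u|] [v|] /=.
Qed.

Definition fpf_involution (V : finType) (tau : {perm V}) : bool :=
  (tau * tau == 1)%g && [forall v, tau v != v].

Definition vperm_mx (R : realType) (V : finType) (tau : {perm V}) :
    'M[R]_#|V| :=
  \matrix_(i, j) (enum_val j == tau (enum_val i))%:R.

Definition inv_defect (R : realType) (V : finType) (w : V -> V -> R) : R :=
  finmin (@fpf_involution V) (fun tau =>
    4^-1 * norm2 (adjmx w - vperm_mx R tau *m adjmx w *m vperm_mx R tau) ^+ 2).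

(* Main.v *)
Require Import Defs.
From HB Require Import structures.
From mathcomp Require Import all_boot all_order all_algebra all_fingroup.
From mathcomp Require Import complex.
From mathcomp Require Import all_classical all_reals all_analysis.
From mathcomp Require Import ring lra.

Set Implicit Arguments.
Unset Strict Implicit.
Unset Printing Implicit Defensive.

Import Order.TTheory GRing.Theory Num.Theory.
Local Open Scope ring_scope.

(* Write D(r,v) for the unnormalized two-dimensional Fourier transform of W_pi.
   Translating pi multiplies the entries of D by phases, so the cone vertex may
   sit at 0. Let sigma(r,v) be -1 if r and v are both nonzero and 1 otherwise,
   rho = sigma Re D and S = 2s. The cone weights dominate, whence
   2M - S <= rho <= |D| <= 2MN, and by orthogonality the sum of rho is N T.
   Hence the excess norm is the sum of
   |D| - rho = (Im D)^2 / (|D| + rho), and by Parseval the sum of (Im D)^2 is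
   N^2/4 times the squared norm of W_pi(x,y) - W_pi(-x,-y).
   As N is odd, x |-> -x has 0 as its only fixed point, so pi transports it to
   a fixed-point-free involution tau of the vertices of H, and every such tau
   arises from some pi. *)

(** * Characters of the cyclic group *)

Section Characters.
Variables (K : numClosedFieldType) (n : nat) (z : K).
Hypothesis prim_z : n.+1.-primitive_root z.
Implicit Types r x y v : 'I_n.+1.

Definition chi r x : K := z ^+ (r * x).

Lemma chiC r x : chi r x = chi x r.
Proof. by rewrite /chi mulnC. Qed.

Lemma chi0 r : chi r 0 = 1.
Proof. by rewrite /chi muln0. Qed.

Lemma chi_add r x y : chi r (x + y) = chi r x * chi r y.
Proof.
rewrite /chi -exprD -mulnDr -(prim_expr_mod prim_z) modnMmr.
by rewrite prim_expr_mod.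
Qed.

Lemma norm_chi r x : `|chi r x| = 1.
Proof.
rewrite normrX; suff /eqP->: `|z| == 1 by rewrite expr1n.
by rewrite -(@pexpr_eq1 _ _ n.+1) // -normrX (prim_expr_order prim_z) normr1.
Qed.

Lemma chi_opp r x : chi r (- x) = (chi r x)^*.
Proof.
have nz : chi r x != 0 by rewrite -normr_eq0 norm_chi oner_eq0.
apply: (mulfI nz); rewrite -chi_add subrr chi0.
by rewrite -normCK norm_chi expr1n.
Qed.

Lemma sum_chi x : \sum_r chi r x = (n.+1%:R *+ (x == 0)).
Proof.
case: eqVneq => [->|x0].
  by under eq_bigr do rewrite chi0; rewrite sumr_const card_ord.
(* As 0 < x < n+1, this factor is nonzero; multiplying by it telescopes the geometric series to
   z^(x(n+1)) - 1 = 0. *)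
have nz : z ^+ x - 1 != 0.
  rewrite subr_eq0 -(prim_order_dvd prim_z) gtnNdvd ?ltn_ord // lt0n.
  by apply: contra_neq x0 => x0; apply: val_inj.
apply: (mulfI nz); rewrite mulr0.
under eq_bigr do rewrite /chi mulnC exprM.
by rewrite -subrX1 exprAC (prim_expr_order prim_z) expr1n subrr.
Qed.

(** Expanding the square and summing over [r] first, orthogonality keeps only the diagonal terms. *)
Lemma chi_parseval (f : 'I_n.+1 -> K) :
  \sum_r `|\sum_x f x * chi r x| ^+ 2 = n.+1%:R * \sum_x `|f x| ^+ 2.
Proof.
under eq_bigr => r _.
  rewrite normCK rmorph_sum /= big_distrlr /=.
  under eq_bigr => x _ do under eq_bigr => y _ do
    rewrite rmorphM /= -chi_opp mulrACA -chi_add.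
  over.
rewrite exchange_big /= mulr_sumr; apply: eq_bigr => x _.
rewrite exchange_big /=.
under eq_bigr => y _ do rewrite -mulr_sumr sum_chi subr_eq0.
rewrite (bigD1 x) //= eqxx big1 ?addr0 => [|y]; first by rewrite -normCK mulrC.
by rewrite eq_sym => /negPf->; rewrite mulr0.
Qed.

(** No normalization and no sign in the exponent: the negative sign of [dft] is carried by the root
    [z]. *)
Definition dft2 (f : 'I_n.+1 -> 'I_n.+1 -> K) r v : K :=
  \sum_x \sum_y f x y * chi r x * chi v y.

Lemma dft2_parseval f :
  \sum_r \sum_v `|dft2 f r v| ^+ 2
    = n.+1%:R ^+ 2 * \sum_x \sum_y `|f x y| ^+ 2.
Proof.
(* One-dimensional Parseval is applied in [r] for fixed [v], then in [v] for fixed [x]. *)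
rewrite exchange_big /=.
have E v : \sum_r `|dft2 f r v| ^+ 2
    = n.+1%:R * \sum_x `|\sum_y f x y * chi v y| ^+ 2.
  rewrite -chi_parseval; apply: eq_bigr => r _; congr (`|_| ^+ 2).
  apply: eq_bigr => x _; rewrite mulr_suml; apply: eq_bigr => y _.
  by rewrite mulrAC.
under eq_bigr do rewrite E.
rewrite -mulr_sumr exchange_big expr2 -mulrA; congr (_ * _).
by rewrite mulr_sumr; apply: eq_bigr => x _; rewrite chi_parseval.
Qed.

(** Reindexing pulls out the unimodular phase [chi r (- c) * chi v (- c)]. *)
Lemma norm_dft2_shift f c r v :
  `|dft2 (fun x y => f (x + c) (y + c)) r v| = `|dft2 f r v|.
Proof.
rewrite -[RHS](_ : `|chi r (- c) * chi v (- c) * dft2 f r v| = _); last first.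
  by rewrite !normrM !norm_chi !mul1r.
congr (`|_|); rewrite mulr_sumr [LHS](reindex_inj (addIr (- c))) /=.
apply: eq_bigr => x _; rewrite mulr_sumr [LHS](reindex_inj (addIr (- c))) /=.
apply: eq_bigr => y _; rewrite !addrNK !chi_add. ring.
Qed.

Lemma norm_dft2_le f r v :
  `|dft2 f r v| <= \sum_x \sum_y `|f x y|.
Proof.
apply: (le_trans (ler_norm_sum _ _ _)); apply: ler_sum => x _.
apply: (le_trans (ler_norm_sum _ _ _)); apply: ler_sum => y _.
by rewrite !normrM !norm_chi !mulr1.
Qed.

Lemma sum_dft2_col f r : \sum_v dft2 f r v = n.+1%:R * \sum_x f x 0 * chi r x.
Proof.
rewrite exchange_big /= mulr_sumr; apply: eq_bigr => x _.
rewrite exchange_big /=.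
under eq_bigr do rewrite -mulr_sumr sum_chi.
rewrite (bigD1 0) //= big1 ?addr0 => [|y /negPf->]; last by rewrite mulr0.
by rewrite mulrC.
Qed.

Lemma sum_dft2_row f v : \sum_r dft2 f r v = n.+1%:R * \sum_y f 0 y * chi v y.
Proof.
rewrite exchange_big /= mulr_sumr.
have E x : \sum_r \sum_y f x y * chi r x * chi v y
    = n.+1%:R *+ (x == 0) * \sum_y f x y * chi v y.
  rewrite exchange_big mulr_sumr; apply: eq_bigr => y _ /=.
  by rewrite -mulr_suml -mulr_sumr sum_chi; ring.
under eq_bigr do rewrite E.
rewrite (bigD1 0) //= addrC big1 ?add0r ?mulr_sumr // => x /negPf->.
by rewrite mul0r.
Qed.

End Characters.

(** * Real parts and moduli of complex numbers *)

Local Open Scope complex_scope.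

Section ComplexParts.
Variable R : rcfType.
Implicit Types z : R[i].

Lemma Re_sum (I : Type) (s : seq I) (P : pred I) (F : I -> R[i]) :
  complex.Re (\sum_(i <- s | P i) F i) = \sum_(i <- s | P i) complex.Re (F i).
Proof.
elim/big_rec2: _ => // i x y _ <-.
by case: (F i) y => [a b] [c d].
Qed.

Lemma normr_normc z : `|z| = (Normc.normc z)%:C.
Proof. by case: z => a b; rewrite normc_def. Qed.

Lemma normc_sqr z : Normc.normc z ^+ 2 = complex.Re z ^+ 2 + complex.Im z ^+ 2.
Proof. by case: z => a b /=; rewrite sqr_sqrtr // addr_ge0 // sqr_ge0. Qed.

Lemma normc_ge0 z : 0 <= Normc.normc z.
Proof. by case: z => a b; apply: sqrtr_ge0. Qed.

Lemma Re_le_normc z : `|complex.Re z| <= Normc.normc z.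
Proof.
case: z => a b /=; rewrite -sqrtr_sqr ler_wsqrtr //.
by rewrite lerDl sqr_ge0.
Qed.

End ComplexParts.

(** The sign is -1 plus twice the indicator of the cross r = 0 or v = 0, and the cross is summed by
    inclusion-exclusion. *)
Lemma sum_sign_cross (V : zmodType) (n : nat) (g : 'I_n.+1 -> 'I_n.+1 -> V) :
  \sum_r \sum_v (if (r == 0) || (v == 0) then g r v else - g r v)
  = (\sum_v g 0 v) *+ 2 + (\sum_r g r 0) *+ 2 - g 0 0 *+ 2
    - \sum_r \sum_v g r v.
Proof.
have E r : \sum_v (if (r == 0) || (v == 0) then g r v else - g r v)
    = (if r == 0 then (\sum_v g 0 v) *+ 2 - g 0 0 *+ 2 else 0) + g r 0 *+ 2
      - \sum_v g r v.
  case: eqVneq => [->|r0] /=.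
    by rewrite subrK mulr2n addrK.
  rewrite add0r (bigD1 0) //= [in RHS](bigD1 0) //= opprD addrA mulr2n addrK.
  by congr (_ + _); rewrite -sumrN; apply: eq_bigr => v /negPf->.
under eq_bigr do rewrite E.
rewrite sumrB big_split /= -big_mkcond /= big_pred1_eq !sumrMnl.
by congr (_ - _); exact: addrAC.
Qed.

(** The product of [d - rho] and [d + rho] is [im ^+ 2], and [d + rho] lies between 2L and 2U. *)
Lemma sub_normc_bounds (R : realFieldType) (d rho im L U : R) :
  0 < L -> L <= rho -> 0 <= d -> d <= U -> d ^+ 2 = rho ^+ 2 + im ^+ 2 ->
  im ^+ 2 / (2 * U) <= d - rho <= im ^+ 2 / (2 * L).
Proof.
move=> L0 Lr d0 dU e.
have rd : rho <= d by nra.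
rewrite ler_pdivlMr ?ler_pdivrMr; [|lra|lra].
have -> : im ^+ 2 = (d - rho) * (d + rho) by rewrite -subr_sqr e addrC addKr.
by apply/andP; split; apply: ler_wpM2l; lra.
Qed.

(** * Spectrum of a cone with apex at 0 *)

Section ConeSpectrum.
Variables (R : rcfType) (n : nat) (z : R[i]) (M S : R).
Variable W : 'I_n.+1 -> 'I_n.+1 -> R.
Hypothesis prim_z : n.+1.-primitive_root z.
Hypothesis n_ge3 : (3 <= n)%N.
Hypothesis W_ge0 : forall x y, 0 <= W x y.
Hypothesis W00 : W 0 0 = 0.
Hypothesis W0x : forall x, x != 0 -> W 0 x = M.
Hypothesis Wx0 : forall x, x != 0 -> W x 0 = M.
Implicit Types r x y v : 'I_n.+1.

Hypothesis SE : S = \sum_(x | x != 0) \sum_(y | y != 0) W x y.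
Hypothesis S_lt : S < 2 * M.

Let G r v : R[i] := dft2 z (fun x y => (W x y)%:C) r v.

Lemma cone_sum_row : \sum_x W x 0 = n%:R * M.
Proof.
rewrite (bigD1 0) //= W00 add0r (eq_bigr (fun=> M)) => [|x /Wx0 //].
by rewrite sumr_const cardC1 card_ord mulr_natl.
Qed.

Lemma cone_sum_col : \sum_y W 0 y = n%:R * M.
Proof.
rewrite (bigD1 0) //= W00 add0r (eq_bigr (fun=> M)) => [|x /W0x //].
by rewrite sumr_const cardC1 card_ord mulr_natl.
Qed.

Lemma cone_total : \sum_x \sum_y W x y = 2 * (n%:R * M) + S.
Proof.
rewrite (bigD1 0) //= cone_sum_col.
under eq_bigr do rewrite (bigD1 0) //=.
rewrite big_split /= -SE; have := cone_sum_row.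
rewrite (bigD1 0) //= W00 add0r => ->; ring.
Qed.

Lemma cone_dft2_00 : G 0 0 = (2 * (n%:R * M) + S)%:C.
Proof.
rewrite -cone_total rmorph_sum; apply: eq_bigr => x _.
rewrite rmorph_sum; apply: eq_bigr => y _.
by rewrite ![chi _ 0 _]chiC !chi0 !mulr1.
Qed.

Lemma cone_sum_dft2_row0 : \sum_v G 0 v = (n.+1%:R * (n%:R * M))%:C.
Proof.
rewrite sum_dft2_col // rmorphM -cone_sum_row rmorph_nat rmorph_sum.
by congr (_ * _); apply: eq_bigr => x _; rewrite chiC chi0 mulr1.
Qed.

Lemma cone_sum_dft2_col0 : \sum_r G r 0 = (n.+1%:R * (n%:R * M))%:C.
Proof.
rewrite sum_dft2_row // rmorphM -cone_sum_col rmorph_nat rmorph_sum.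
by congr (_ * _); apply: eq_bigr => x _; rewrite chiC chi0 mulr1.
Qed.

(** Fourier inversion at the origin: the total is (n+1)^2 times [W 0 0]. *)
Lemma cone_sum_dft2 : \sum_r \sum_v G r v = 0.
Proof.
under eq_bigr do rewrite sum_dft2_col //.
rewrite -mulr_sumr exchange_big big1 ?mulr0 //= => x _.
rewrite -mulr_sumr sum_chi //; case: eqVneq => [->|_]; last by rewrite mulr0.
by rewrite W00 mul0r.
Qed.

Let rho r v : R := if (r == 0) || (v == 0) then complex.Re (G r v)
                   else - complex.Re (G r v).

(** In [sum_sign_cross] the zero row and the zero column each give 2(n+1)nM, the corner subtracts
    2(2nM + S), and the full sum vanishes. *)
Lemma cone_sum_rho : \sum_r \sum_v rho r v = 4 * M * n%:R ^+ 2 - 2 * S.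
Proof.
rewrite sum_sign_cross -!Re_sum cone_dft2_00 cone_sum_dft2_row0.
rewrite cone_sum_dft2_col0.
under eq_bigr do rewrite -Re_sum.
by rewrite -Re_sum cone_sum_dft2 /= -natr1; ring.
Qed.

(** The cone edges contribute M times two character sums over nonzero indices, each equal to -1 plus
    n+1 if its frequency is zero. What remains is the transform of the base graph. *)
Lemma cone_dft2E r v :
  G r v = (M * ((n.+1 * (r == 0%R))%N%:R + (n.+1 * (v == 0%R))%N%:R - 2))%:C
    + \sum_(x | x != 0) \sum_(y | y != 0) (W x y)%:C * chi z r x * chi z v y.
Proof.
have E (u : 'I_n.+1) :
    \sum_(x | x != 0) chi z u x = ((n.+1 * (u == 0%R))%N%:R - 1)%:C.
  have := sum_chi prim_z u.
  rewrite (bigD1 0) //= chiC chi0 => /(canRL (addKr _)).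
  rewrite rmorphB rmorph_nat rmorph1 natrM mulr_natr [RHS]addrC => <-.
  by apply: eq_bigr => x _; rewrite chiC.
rewrite /G /dft2 (bigD1 0) //=.
under [X in _ + X]eq_bigr do rewrite (bigD1 0) //=.
rewrite big_split /= addrA; congr (_ + _).
rewrite (bigD1 0) //= W00 rmorph0 !mul0r add0r.
rewrite (eq_bigr (fun y => M%:C * chi z v y)) => [|y /W0x->]; last first.
  by rewrite chi0 mulr1.
rewrite [X in _ + X](eq_bigr (fun x => M%:C * chi z r x)) => [|x /Wx0->];
  last first.
  by rewrite chi0 mulr1.
rewrite -!mulr_sumr !E -mulrDr -rmorphD -rmorphM; congr (_%:C); ring.
Qed.

(** The base part [E] has modulus at most S. The cone part is real: 2nM at the corner, (n-1)M on the
    rest of the cross and -2M off it. After the sign change it is at least 2M, since n >= 3. *)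
Lemma cone_rho_ge r v : 2 * M - S <= rho r v.
Proof.
pose E :=
  \sum_(x | x != 0) \sum_(y | y != 0) (W x y)%:C * chi z r x * chi z v y.
have ES : Normc.normc E <= S.
  rewrite -lecR -normr_normc SE rmorph_sum /=.
  apply: (le_trans (ler_norm_sum _ _ _)); apply: ler_sum => x _.
  rewrite rmorph_sum /=.
  apply: (le_trans (ler_norm_sum _ _ _)); apply: ler_sum => y _.
  by rewrite !normrM !norm_chi // !mulr1 ger0_norm // ler0c.
have /ler_normlP[E1 E2] := le_trans (Re_le_normc E) ES.
have M0 : 0 <= M.
  have : 0 <= S by rewrite SE; apply: sumr_ge0 => x _; apply: sumr_ge0 => y _.
  by move: S_lt => lt_S S0; lra.
have nM : 4 * M <= n.+1%:R * M by apply: ler_wpM2r; rewrite // ler_nat.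
rewrite /rho cone_dft2E -/E.
have -> a : complex.Re (a%:C + E) = a + complex.Re E by case: (E).
case: (r == 0); case: (v == 0); rewrite /= ?muln1 ?muln0; nra.
Qed.

(** The modulus is at most the total weight 2nM + S, and S < 2M. *)
Lemma cone_normc_dft2_le r v : Normc.normc (G r v) <= 2 * (M * n.+1%:R).
Proof.
have : Normc.normc (G r v) <= \sum_x \sum_y W x y.
  rewrite -lecR -normr_normc; apply: le_trans (norm_dft2_le prim_z _ _ _) _.
  rewrite rmorph_sum /=; apply: ler_sum => x _.
  rewrite rmorph_sum /=; apply: ler_sum => y _.
  by rewrite ger0_norm // ler0c.
by rewrite cone_total -natr1; move: S_lt => lt_S le_G; lra.
Qed.

(** Negating both indices of the real matrix W conjugates its transform, so the difference [f] has
    transform 2i Im G. Parseval for [f] then gives the claim, the 4 coming from the square of 2i. *)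
Lemma sum_Im_dft2_sqr :
  \sum_r \sum_v complex.Im (G r v) ^+ 2
  = n.+1%:R ^+ 2 * (4^-1 * \sum_x \sum_y (W x y - W (- x) (- y)) ^+ 2).
Proof.
pose f x y : R[i] := (W x y - W (- x) (- y))%:C.
have fE r v : dft2 z f r v = G r v - (G r v)^*.
  have cE : (G r v)^* = dft2 z (fun x y => (W (- x) (- y))%:C) r v.
    rewrite rmorph_sum (reindex_inj oppr_inj); apply: eq_bigr => x _ /=.
    rewrite rmorph_sum (reindex_inj oppr_inj); apply: eq_bigr => y _ /=.
    rewrite !rmorphM /= !chi_opp //.
    congr (_ * _ * _); [exact: conjc_real | exact: conjcK | exact: conjcK].
  apply: etrans (congr1 (fun u => G r v - u) (esym cE)).
  rewrite -sumrB; apply: eq_bigr => x _; rewrite -sumrB; apply: eq_bigr => y _.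
  by rewrite /f rmorphB !mulrBl.
have fI r v : `|dft2 z f r v| ^+ 2 = (4 * complex.Im (G r v) ^+ 2)%:C.
  rewrite fE normr_normc -rmorphXn normc_sqr; congr (_%:C).
  by case: (G r v) => a b /=; ring.
have := dft2_parseval prim_z f.
under eq_bigr do under eq_bigr do rewrite fI.
under eq_bigr do rewrite -rmorph_sum -mulr_sumr.
rewrite -rmorph_sum -mulr_sumr.
have -> : \sum_x \sum_y `|f x y| ^+ 2
    = (\sum_x \sum_y (W x y - W (- x) (- y)) ^+ 2)%:C.
  rewrite rmorph_sum; apply: eq_bigr => x _.
  rewrite rmorph_sum; apply: eq_bigr => y _.
  by rewrite normr_normc -rmorphXn normc_sqr /= expr0n addr0.
rewrite -(rmorph_nat (real_complex R)) -rmorphXn -rmorphM => /complexI; lra.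
Qed.

Lemma cone_dft2_norm1_bounds (a := 4^-1 *
    \sum_x \sum_y (W x y - W (- x) (- y)) ^+ 2) :
  a / (4 * M)
  <= (\sum_r \sum_v Normc.normc (G r v)) / n.+1%:R
     - (4 * M * n%:R ^+ 2 - 2 * S) / n.+1%:R
  <= n.+1%:R * a / (2 * (2 * M - S)).
Proof.
have M0 : 0 < M.
  have : 0 <= S by rewrite SE; apply: sumr_ge0 => x _; apply: sumr_ge0 => y _.
  by move: S_lt => lt_S S0; lra.
have N0 : 0 < n.+1%:R :> R by rewrite ltr0n.
(* The squares of the imaginary parts sum to (n+1)^2 a. After the division by n+1, the lower bound
   loses its last factor n+1 to the one in its denominator, while the upper bound keeps it. *)
have pt r v : complex.Im (G r v) ^+ 2 / (2 * (2 * (M * n.+1%:R)))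
    <= Normc.normc (G r v) - rho r v
    <= complex.Im (G r v) ^+ 2 / (2 * (2 * M - S)).
  apply: sub_normc_bounds;
    rewrite ?cone_rho_ge ?normc_ge0 ?cone_normc_dft2_le //.
    by rewrite subr_gt0.
  by rewrite normc_sqr /rho; case: ifP; rewrite ?sqrrN.
rewrite -mulrBl -cone_sum_rho -sumrB.
under eq_bigr do rewrite -sumrB.
rewrite ler_pdivlMr // ler_pdivrMr //; apply/andP; split.
  have -> : a / (4 * M) * n.+1%:R
      = n.+1%:R ^+ 2 * a / (2 * (2 * (M * n.+1%:R))).
    by field; rewrite !gt_eqF.
  rewrite -sum_Im_dft2_sqr mulr_suml; apply: ler_sum => r _.
  by rewrite mulr_suml; apply: ler_sum => v _; case/andP: (pt r v).
rewrite mulrAC -[_ * a * _]mulrA [a * _]mulrC mulrA -expr2.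
rewrite -sum_Im_dft2_sqr mulr_suml; apply: ler_sum => r _.
by rewrite mulr_suml; apply: ler_sum => v _; case/andP: (pt r v).
Qed.

End ConeSpectrum.

(** * The Fourier matrix *)

Section FourierMatrix.
Variable R : realType.

Lemma expiX (t : R) k : expi t ^+ k = expi (k%:R * t).
Proof.
elim: k => [|k IH]; first by rewrite expr0 mul0r /expi cos0 sin0.
rewrite exprS IH -nat1r mulrDl mul1r /expi cosD sinD; simpc.
by congr (_ +i* _); ring.
Qed.

Definition zeta N : R[i] := expi (- (2 * pi / N%:R)).

Lemma zeta_prim n : n.+1.-primitive_root (zeta n.+1).
Proof.
have N0 : n.+1%:R != 0 :> R by rewrite pnatr_eq0.
have zN : zeta n.+1 ^+ n.+1 = 1.
  rewrite expiX mulrN mulrC divfK // /expi cosN sinN mulr_natl.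
  by rewrite cos2pi sin2pi oppr0.
have [m prim_m m_dvd] := prim_order_exists (ltn0Sn n) zN.
suff e : m = n.+1 by rewrite e in prim_m.
apply/eqP; rewrite eqn_leq dvdn_leq //= leqNgt; apply/negP => lt_m.
have m0 := prim_order_gt0 prim_m.
have := prim_expr_order prim_m; rewrite expiX mulrN => -[+ _]; rewrite cosN.
have -> : m%:R * (2 * pi / n.+1%:R) = (m%:R * pi / n.+1%:R) *+ 2 :> R.
  by rewrite -mulr_natl; field.
(* If the order m were below n+1, then t = m pi / (n+1) would lie strictly between 0 and pi, so
   cos(2t) = 1 - 2 sin(t)^2 < 1, although z^m = 1 forces cos(2t) = 1. *)
have : 0 < sin (m%:R * pi / n.+1%:R : R).
  apply: sin_gt0_pi; rewrite divr_gt0 ?mulr_gt0 ?pi_gt0 ?ltr0n //=.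
  by rewrite ltr_pdivrMr ?ltr0n // mulrC ltr_pM2l ?pi_gt0 ?ltr_nat.
move: (m%:R * pi / n.+1%:R) => t st.
have := cos2Dsin2 t; rewrite cos_mulr2n -mulr_natl; nra.
Qed.

(** The two Fourier factors contribute 1/sqrt(n+1) each, which gives the division by n+1. *)
Lemma norm1_dftE n (f : 'I_n.+1 -> 'I_n.+1 -> R) :
  Defs.norm1 (dft R n.+1
    *m map_mx (real_complex R) (\matrix_(x, y) f x y) *m dft R n.+1)
  = (\sum_r \sum_v Normc.normc
       (dft2 (zeta n.+1) (fun x y => (f x y)%:C) r v)) / n.+1%:R.
Proof.
have N0 : 0 <= (n.+1%:R : R)^-1 by rewrite invr_ge0.
have dftE r x : dft R n.+1 r x
    = ((Num.sqrt (n.+1%:R : R))^-1)%:C * chi (zeta n.+1) r x.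
  rewrite mxE; congr (_ * _); rewrite /chi expiX; congr expi.
  by rewrite natrM; ring.
rewrite mulr_suml; apply: eq_bigr => r _.
rewrite mulr_suml; apply: eq_bigr => v _.
suff -> : (dft R n.+1 *m map_mx (real_complex R) (\matrix_(x, y) f x y)
      *m dft R n.+1) r v
    = (n.+1%:R^-1)%:C * dft2 (zeta n.+1) (fun x y => (f x y)%:C) r v.
  apply: complexI; rewrite rmorphM -!normr_normc normrM mulrC.
  by rewrite [X in _ * X]ger0_norm // ler0c.
have -> : (n.+1%:R^-1 : R) = (Num.sqrt n.+1%:R)^-1 * (Num.sqrt n.+1%:R)^-1.
  by rewrite -invfM -expr2 sqr_sqrtr.
rewrite rmorphM /dft2 exchange_big mxE mulr_sumr; apply: eq_bigr => y _ /=.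
rewrite mxE mulr_sumr mulr_suml; apply: eq_bigr => x _ /=.
by rewrite !dftE !mxE (chiC _ y v); ring.
Qed.

End FourierMatrix.

(** * Labelings and involutions *)

(** If -x = x then n+1 divides 2x, hence x, because n+1 is odd. *)
Lemma Zp_oppr_neq n (x : 'I_n.+1) : ~~ odd n -> x != 0 -> - x != x.
Proof.
move=> n_even; apply: contra_neq => /(congr1 (+%R x)).
rewrite subrr => /(congr1 val) /= /esym/eqP; rewrite -/(dvdn _ _) addnn -muln2.
rewrite Gauss_dvdl ?coprimen2 //= ?n_even // => /dvdnP[k e].
apply: val_inj => /=; move: (ltn_ord x); rewrite e.
by case: k {e} => // k; rewrite mulSn ltnNge leq_addr.
Qed.

Lemma big_option (A : Type) (idx : A) (op : Monoid.com_law idx) (V : finType)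
    (F : option V -> A) :
  \big[op/idx]_a F a = op (F None) (\big[op/idx]_v F (Some v)).
Proof.
rewrite (bigD1 None) //=; congr (op _ _); case: (pickP (@predT V)) => [v0 _|V0].
  rewrite (reindex_omap Some id) => [|[v|] //].
  by apply: eq_bigl => v; rewrite /= eqxx.
by rewrite !big_pred0 // => -[v|//]; have := V0 v.
Qed.

Lemma big_option_neq (A : Type) (idx : A) (op : Monoid.com_law idx)
    (V : finType) (F : option V -> A) :
  \big[op/idx]_(a | a != None) F a = \big[op/idx]_v F (Some v).
Proof.
rewrite (reindex_omap Some id) => [|[v|] //].
by apply: eq_bigl => v; rewrite /= eqxx.
Qed.

Lemma fpf_involutionP (V : finType) (tau : {perm V}) :
  reflect (involutive tau /\ forall v, tau v != v) (fpf_involution tau).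
Proof.
apply: (iffP andP) => -[].
  by move=> /eqP e /forallP ne; split=> // v; rewrite -permM e perm1.
move=> inv ne; split; last exact/forallP.
by apply/eqP/permP => v; rewrite permM inv perm1.
Qed.

(* tau is conjugated to negation by listing one point of each tau-orbit,
   followed by the images in reverse order. *)
Lemma labeling_of_involution n (V : finType) (tau : {perm V}) :
  #|V| = n -> fpf_involution tau ->
  exists p : 'I_n.+1 -> option V,
    [/\ bijective p, p 0 = None & forall x, p (- x) = omap tau (p x)].
Proof.
move=> Vn /fpf_involutionP[inv ne].
(* Each two-point orbit is represented by its element of smaller rank. *)
pose s := enum [pred v | enum_rank v < enum_rank (tau v)]%N.
pose q := s ++ rev (map tau s).
have inj_tau : injective tau by exact: perm_inj.
have mem_map_tau v : (v \in map tau s) = (tau v \in s).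
  by rewrite -{1}(inv v) mem_map.
have s_or v : (v \in s) (+) (tau v \in s).
  rewrite !mem_enum !inE inv; case: ltngtP => // /val_inj/enum_rank_inj e.
  by have := ne v; rewrite -e eqxx.
have q_uniq : uniq q.
  rewrite cat_uniq rev_uniq map_inj_uniq // enum_uniq andbT /=.
  apply/hasPn => v; rewrite mem_rev mem_map_tau => h.
  by have := s_or v; rewrite h addbT.
have mem_q v : v \in q.
  by rewrite mem_cat mem_rev mem_map_tau; have := s_or v; case: (v \in s).
have size_q : size q = n.
  rewrite -Vn cardE; apply: perm_size; apply: uniq_perm; rewrite ?enum_uniq //.
  by move=> v; rewrite mem_q mem_enum.
(* Mirror positions of [q] are exchanged by [tau]. *)
have q_rev : q = rev (map tau q).
  by rewrite map_cat rev_cat map_rev revK -map_comp map_id_in // => v _ /=.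
pose l := None :: map Some q.
have l_uniq : uniq l.
  rewrite /= map_inj_uniq ?q_uniq ?andbT; last by move=> ? ? [].
  by apply/mapP => -[].
exists (fun x => nth None l x); split=> //.
  apply: inj_card_bij; last by rewrite card_option card_ord Vn.
  move=> x y /eqP; rewrite nth_uniq //= ?size_map ?size_q // => /eqP.
  exact: val_inj.
move=> x; case: (eqVneq x 0) => [->|x0]; first by rewrite oppr0.
(* Index k+1 of [l] is entry k of [q]; its negative n-k is entry n-k-1, the mirror of k. *)
case: x x0 => -[//|k] lt_k _ /=.
rewrite modn_small ?subSS; last by rewrite ltnS leq_subr.
have lt_kn : (k < n)%N by [].
have v0 : V.
  move: q size_q {q_uniq mem_q q_rev l l_uniq} => [|v //] e.
  by rewrite -e in lt_kn.
have lt_j : (n - k.+1 < n)%N by rewrite ltn_subrL /= (leq_trans _ lt_kn).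
have -> : (n - k = (n - k.+1).+1)%N by rewrite -subSn // subSS.
rewrite /= !(nth_map v0) ?size_q //= [in LHS]q_rev nth_rev ?size_map ?size_q //.
by rewrite subnSK // subKn 1?ltnW // (nth_map v0) ?size_q.
Qed.

Lemma involution_of_labeling n (V : finType) (p : 'I_n.+1 -> option V) :
  ~~ odd n -> bijective p -> p 0 = None ->
  exists2 tau : {perm V}, fpf_involution tau
    & forall x, p (- x) = omap tau (p x).
Proof.
move=> n_even [g pK gK] p0.
(* Negation transported by [p]. The default is never reached: [p] takes the value [None] only at 0,
   and [g (Some v)] is nonzero. *)
pose f v := odflt v (p (- g (Some v))).
have fE v : p (- g (Some v)) = Some (f v).
  rewrite /f; case e: (p _) => [//|]; move: e; rewrite -p0 => /(can_inj pK)/eqP.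
  by rewrite oppr_eq0 => /eqP e; have := gK (Some v); rewrite e p0.
have inv_f : involutive f.
  by move=> v; apply: Some_inj; rewrite -fE -fE pK opprK gK.
exists (perm (inv_inj inv_f)).
  apply/fpf_involutionP; split=> v; rewrite !permE //.
  have gv0 : g (Some v) != 0.
    by apply/eqP => e; have := gK (Some v); rewrite e p0.
  apply: contra_neq (Zp_oppr_neq n_even gv0) => e; apply: (can_inj pK).
  by rewrite fE gK e.
move=> x; case e: (p x) => [v|] /=.
  by rewrite permE -fE -e pK.
by move: e; rewrite -p0 => /(can_inj pK)->; rewrite oppr0.
Qed.

(** * Double sums, the Frobenius norm and the defect of an involution *)

Lemma sum_sym_upper (R : pzRingType) m (F : 'I_m -> 'I_m -> R) :
  (forall i j, F i j = F j i) -> (forall i, F i i = 0) ->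
  \sum_i \sum_j F i j = 2 * \sum_(i < m) \sum_(j < m | (i < j)%N) F i j.
Proof.
move=> Fsym Fdiag.
have E i : \sum_j F i j
    = \sum_(j < m | (i < j)%N) F i j + \sum_(j < m | (j < i)%N) F i j.
  rewrite (bigD1 i) //= Fdiag add0r (bigID (fun j : 'I_m => (i < j)%N)) /=.
  congr (_ + _); apply: eq_bigl => j.
    by rewrite -val_eqE /=; case: ltngtP.
  by rewrite -val_eqE /=; case: ltngtP.
under eq_bigr do rewrite E.
rewrite big_split /= mulr_natl mulr2n; congr (_ + _).
rewrite (exchange_big_dep predT) //=.
by apply: eq_bigr => i _; apply: eq_bigr => j _; rewrite Fsym.
Qed.

Lemma sum_enum_val2 (R : nmodType) (V : finType) (F : V -> V -> R) :
  \sum_(i < #|V|) \sum_(j < #|V|) F (enum_val i) (enum_val j)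
  = \sum_u \sum_v F u v.
Proof.
pose e : 'I_#|V| -> V := enum_val.
have bij_e P : {on P, bijective e} by apply: onW_bij; exact: enum_val_bij.
rewrite [RHS](reindex e) //; apply: eq_bigr => i _.
by rewrite [RHS](reindex e).
Qed.

Lemma norm2_sqr (R : realType) m k (C : 'M[R]_(m, k)) :
  Defs.norm2 C ^+ 2 = \sum_i \sum_j C i j ^+ 2.
Proof.
rewrite sqr_sqrtr; last first.
  by apply: sumr_ge0 => i _; apply: sumr_ge0 => j _; rewrite sqr_ge0.
by apply: eq_bigr => i _; apply: eq_bigr => j _; rewrite real_normK ?num_real.
Qed.

Lemma norm2_ge0 (R : realType) m k (C : 'M[R]_(m, k)) : 0 <= Defs.norm2 C.
Proof. exact: sqrtr_ge0. Qed.

Lemma norm2_adjmx (R : realType) (V : finType) (w : V -> V -> R) :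
  Defs.norm2 (adjmx w) = Num.sqrt (\sum_u \sum_v w u v ^+ 2).
Proof.
rewrite -[LHS]ger0_norm ?norm2_ge0 // -sqrtr_sqr norm2_sqr.
rewrite -(sum_enum_val2 (fun u v => w u v ^+ 2)).
by congr Num.sqrt; apply: eq_bigr => i _; apply: eq_bigr => j _; rewrite mxE.
Qed.

(** The quantity minimized by [inv_defect], summed over vertices rather than matrix indices. *)
Definition defect (R : realType) (V : finType) (w : V -> V -> R)
    (tau : {perm V}) : R :=
  4^-1 * \sum_u \sum_v (w u v - w (tau u) (tau v)) ^+ 2.

Lemma defect_norm2 (R : realType) (V : finType) (w : V -> V -> R)
    (tau : {perm V}) : fpf_involution tau ->
  4^-1 * Defs.norm2 (adjmx w - vperm_mx R tau *m adjmx w *m vperm_mx R tau) ^+ 2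
  = defect w tau.
Proof.
move=> /fpf_involutionP[inv _]; rewrite norm2_sqr /defect.
rewrite -(sum_enum_val2 (fun u v => (w u v - w (tau u) (tau v)) ^+ 2)).
congr (_ * _); apply: eq_bigr => i _; apply: eq_bigr => j _.
rewrite !mxE; congr ((_ - _) ^+ 2).
(* The right factor selects the k with tau(k) = j, which is tau(j) as [tau] is an involution; the
   left factor selects tau(i). *)
rewrite (bigD1 (enum_rank (tau (enum_val j)))) //= big1 ?addr0 => [|k kj].
  rewrite !mxE enum_rankK inv eqxx mulr1.
  rewrite (bigD1 (enum_rank (tau (enum_val i)))) //= big1 ?addr0 => [|k ki].
    by rewrite !mxE !enum_rankK eqxx mul1r.
  rewrite !mxE; case: eqP => [e|]; last by rewrite mul0r.
  by rewrite -e enum_valK eqxx in ki.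
rewrite !mxE; case: eqP => [e|]; last by rewrite mulr0.
by rewrite e inv enum_valK eqxx in kj.
Qed.

Lemma inv_defect_le (R : realType) (V : finType) (w : V -> V -> R)
  (tau : {perm V}) : fpf_involution tau -> inv_defect w <= defect w tau.
Proof.
by move=> ftau; rewrite -(defect_norm2 w ftau); exact: finmin_le.
Qed.

(** The given [tau] shows that the minimum is over a nonempty set, so [finmin] does not return its
    default 0. *)
Lemma inv_defect_attained (R : realType) (V : finType) (w : V -> V -> R)
    (tau : {perm V}) : fpf_involution tau ->
  exists2 tau', fpf_involution tau' & inv_defect w = defect w tau'.
Proof.
move=> ftau; rewrite /inv_defect.
have [tau' ftau' ->] := finmin_attained
  (fun tau => 4^-1 * Defs.norm2
    (adjmx w - vperm_mx R tau *m adjmx w *m vperm_mx R tau) ^+ 2) ftau.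
by exists tau'; rewrite ?defect_norm2.
Qed.

(** * From the spectral estimate to the minimum over labelings of the cone *)

Section Cone.
Variables (R : realType) (V : finType) (w : V -> V -> R) (M : R) (n : nat).
Hypothesis hw : nonneg_wgraph w.
Hypothesis card_V : #|V| = n.
Hypothesis n_even : ~~ odd n.
Hypothesis n_ge3 : (3 <= n)%N.
Let S := \sum_u \sum_v w u v.
Hypothesis S_lt : S < 2 * M.

(** The size is a variable so that bounds proved at [n.+1] carry over to [#|{: option V}|] through
    an equation. *)
Let spec N (p : 'I_N -> option V) : R :=
  Defs.norm1 (dft R N
    *m map_mx (real_complex R) (\matrix_(x, y) wcone M w (p x) (p y))
    *m dft R N) - (4 * M * n%:R ^+ 2 - 2 * S) / n.+1%:R.

Let bounded (d x : R) :=
  d / (4 * M) <= x <= n.+1%:R * d / (2 * (2 * M - S)).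

Lemma cone_M_gt0 : 0 < M.
Proof.
have : 0 <= S by apply: sumr_ge0 => u _; apply: sumr_ge0 => v _; case: hw.
by move: S_lt; rewrite -/S => lt_S S0; lra.
Qed.

Lemma spec_bounds (p : 'I_n.+1 -> option V) (tau : {perm V}) :
  bijective p -> p 0 = None -> (forall x, p (- x) = omap tau (p x)) ->
  bounded (defect w tau) (spec p).
Proof.
move=> bij_p p0 p_tau; have [ws wd w0] := hw.
have p_neq0 x : (p x != None) = (x != 0).
  by rewrite -p0 (inj_eq (bij_inj bij_p)).
have reindex_p (P : pred (option V)) (F : option V -> R) :
    \sum_(a | P a) F a = \sum_(x | P (p x)) F (p x).
  by apply: reindex; exact: onW_bij.
have E : defect w tau = 4^-1 * \sum_x \sum_y
    (wcone M w (p x) (p y) - wcone M w (p (- x)) (p (- y))) ^+ 2.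
  congr (_ * _).
  under [RHS]eq_bigr do under eq_bigr do rewrite !p_tau.
  (* Pairs containing the apex add nothing: [omap tau] fixes [None], and every edge at the apex has
     weight M. *)
  transitivity (\sum_a \sum_b
    (wcone M w a b - wcone M w (omap tau a) (omap tau b)) ^+ 2).
    rewrite [RHS]big_option [X in _ = X + _]big1 ?add0r /= =>
      [|[b|] _]; last 2 first.
    - by rewrite subrr expr0n.
    - by rewrite subrr expr0n.
    by apply: eq_bigr => u _; rewrite big_option /= subrr expr0n add0r.
  by rewrite reindex_p; apply: eq_bigr => x _; rewrite reindex_p.
rewrite /bounded E /spec norm1_dftE.
apply: (cone_dft2_norm1_bounds (W := fun x y => wcone M w (p x) (p y))) => //.
- exact: zeta_prim.
- move=> x y; move: cone_M_gt0 => /ltW M0.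
  by case: (p x) (p y) => [u|] [v|] //=.
- by rewrite p0.
- by move=> x; rewrite p0 -p_neq0; case: (p x).
- by move=> x; rewrite p0 -p_neq0; case: (p x).
under [RHS]eq_bigl do rewrite -p_neq0.
under [RHS]eq_bigr do under eq_bigl do rewrite -p_neq0.
under [RHS]eq_bigr => x _ do rewrite -(reindex_p (fun a => a != None)
  (wcone M w (p x))) big_option_neq.
by rewrite -(reindex_p (fun a => a != None)
  (fun a => \sum_v wcone M w a (Some v))) big_option_neq.
Qed.

Lemma labeling_bounds N (p : 'I_N -> option V) : N = n.+1 -> bijective p ->
  exists2 tau : {perm V}, fpf_involution tau & bounded (defect w tau) (spec p).
Proof.
move=> NE; move: p; rewrite NE => p bij_p.
have [g pK gK] := bij_p.
pose p' x := p (x + g None).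
have bij_p' : bijective p'.
  exists (fun a => g a - g None) => [x|a]; first by rewrite pK addrK.
  by rewrite /p' subrK gK.
have p'0 : p' 0 = None by rewrite /p' add0r gK.
have [tau ftau p'_tau] := involution_of_labeling n_even bij_p' p'0.
exists tau => //; suff -> : spec p = spec p' by exact: spec_bounds.
have norm_shift r v : Normc.normc (dft2 (zeta R n.+1)
      (fun x y => (wcone M w (p' x) (p' y))%:C) r v)
    = Normc.normc (dft2 (zeta R n.+1)
      (fun x y => (wcone M w (p x) (p y))%:C) r v).
  apply: complexI; rewrite -!normr_normc.
  exact: (norm_dft2_shift (zeta_prim R n)
    (fun x y => (wcone M w (p x) (p y))%:C)).
rewrite /spec !norm1_dftE.
by under [in RHS]eq_bigr do under eq_bigr do rewrite norm_shift.
Qed.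

Lemma involution_bounds N (tau : {perm V}) : N = n.+1 -> fpf_involution tau ->
  exists2 p : 'I_N -> option V, bijective p & bounded (defect w tau) (spec p).
Proof.
move=> -> ftau.
have [p [bij_p p0 p_tau]] := labeling_of_involution card_V ftau.
by exists p => //; exact: spec_bounds.
Qed.

(** An optimal labeling yields an involution of defect at least the minimum, hence the lower bound;
    an optimal involution yields a labeling of norm at least [Phi], hence the upper bound. *)
Lemma Phi_wcone_bounds :
  bounded (inv_defect w)
    (Phi (wcone M w) - (4 * M * n%:R ^+ 2 - 2 * S) / n.+1%:R).
Proof.
have NE : #|{: option V}| = n.+1 by rewrite card_option card_V.
have M0 := cone_M_gt0.
have bij_ffun (p : 'I_#|{: option V}| -> option V) : bijective p ->
    labeling (finfun p).
  by move=> bij_p; apply/asboolP/(eq_bij bij_p) => x; rewrite ffunE.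
pose f (p : {ffun 'I_#|{: option V}| -> option V}) :=
  Defs.norm1 (dft R #|{: option V}|
    *m map_mx (real_complex R) (labeled_mx (wcone M w) p)
    *m dft R #|{: option V}|).
have [p /asboolP bij_p PhiE] :=
  finmin_attained f (labeling_enum_val (option V)).
have [tau ftau /andP[lb _]] := labeling_bounds NE bij_p.
(* The involution found from the optimal labeling witnesses that some fixed-point-free involution
   exists. *)
have [tau' ftau' aE] := inv_defect_attained w ftau.
have [p' bij_p' /andP[_ ub]] := involution_bounds NE ftau'.
have PhiE' : Phi (wcone M w) = f p := PhiE.
apply/andP; split.
  rewrite PhiE'; apply: le_trans lb.
  by rewrite ler_pM2r ?inv_defect_le // invr_gt0 mulr_gt0.
rewrite aE; apply: le_trans ub; rewrite lerB //.
apply: le_trans (finmin_le f (bij_ffun _ bij_p')) _.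
rewrite /f; suff -> : labeled_mx (wcone M w) (finfun p')
  = \matrix_(x, y) wcone M w (p' x) (p' y) by exact: lexx.
by apply/matrixP => x y; rewrite !mxE !ffunE.
Qed.

Lemma norm2_adjmx_wcone :
  Defs.norm2 (adjmx (wcone M w))
  = Num.sqrt (2 * n%:R * M ^+ 2 + \sum_u \sum_v w u v ^+ 2).
Proof.
rewrite norm2_adjmx; congr Num.sqrt.
rewrite big_option big_option /= expr0n add0r sumr_const card_V.
under eq_bigr do rewrite big_option /=.
by rewrite big_split /= sumr_const card_V -mulr_natl; ring.
Qed.

End Cone.

(* Constants rewritten with sums over unordered pairs, and division by Q *)
Local Close Scope complex_scope.

Theorem theorem4p2 (R : realType) (n : nat) (V : finType) (w : V -> V -> R)
    (M : R) (hw : nonneg_wgraph w) (hn : #|V| = n) (n_even : ~~ odd n)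
    (n_ge4 : (4 <= n)%N) :
  let B := adjmx w in
  let s := \sum_(i < #|V|) \sum_(j < #|V| | (i < j)%N) B i j in
  let t := \sum_(i < #|V|) \sum_(j < #|V| | (i < j)%N) B i j ^+ 2 in
  let N : R := n.+1%:R in
  let T := (4 * M * n%:R ^+ 2 - 4 * s) / N in
  let Q := Num.sqrt (2 * n%:R * M ^+ 2 + 2 * t) in
  let a := inv_defect w in
  s < M ->
  [/\ a / (4 * M) <= Phi (wcone M w) - T <= N * a / (4 * (M - s)),
      a / (4 * M * Q) <= FRmin (wcone M w) - T / Q
                      <= N * a / (4 * (M - s) * Q)
    & 2 * s <= M -> 0 < M -> N * a / (4 * (M - s)) <= N * a / (2 * M)].
Proof.
move=> B s t N T Q a lt_sM; have [ws wd w0] := hw.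
have sE : \sum_u \sum_v w u v = 2 * s.
  rewrite -sum_enum_val2 -sum_sym_upper => [|i j|i]; rewrite ?mxE //.
  by apply: eq_bigr => i _; apply: eq_bigr => j _; rewrite mxE.
have tE : \sum_u \sum_v w u v ^+ 2 = 2 * t.
  rewrite -(sum_enum_val2 (fun u v => w u v ^+ 2)) -sum_sym_upper => [|i j|i].
  - by apply: eq_bigr => i _; apply: eq_bigr => j _; rewrite mxE.
  - by rewrite !mxE ws.
  - by rewrite mxE wd expr0n.
have lt_S : \sum_u \sum_v w u v < 2 * M by rewrite sE ltr_pM2l.
have M0 : 0 < M := cone_M_gt0 hw lt_S.
have a0 : 0 <= a.
  rewrite /a /inv_defect /finmin; case: pickP => // tau _.
  by rewrite mulr_ge0 ?sqr_ge0.
have := Phi_wcone_bounds hw hn n_even (ltnW n_ge4) lt_S.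
(* With S = 2s, the term 2S becomes 4s and the denominator 2(2M - S) becomes 4(M - s). *)
rewrite sE mulrA -natrM -[(2 * 2)%N]/4%N -/T -/a.
rewrite -mulrBr mulrA -natrM -[(2 * 2)%N]/4%N -/N => bounds.
have Q0 : 0 < Q.
  rewrite sqrtr_gt0 -tE ltr_wpDr //.
    by apply: sumr_ge0 => u _; apply: sumr_ge0 => v _; rewrite sqr_ge0.
  by rewrite !mulr_gt0 ?exprn_gt0 // ltr0n (leq_trans _ n_ge4).
split=> //.
  rewrite /FRmin (norm2_adjmx_wcone w M hn) tE -/Q -mulrBl.
  by rewrite !invfM !mulrA !ler_pM2r ?invr_gt0 // -!mulrA -!invfM !mulrA.
(* From 2s <= M follows 4(M - s) >= 2M, and the numerator is nonnegative. *)
move=> le_sM _; apply: ler_wpM2l; first by rewrite mulr_ge0 // ler0n.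
by rewrite lef_pV2 ?posrE; lra.
Qed.
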